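(* There is a $21\,CCZ\to3\,CCZ$ distillation protocol at distance $3$: index 21 columns by the points of the projective plane over $\mathbb F_8$ $$(0:1:\gamma),\quad(\gamma:0:1),\quad(1:\gamma:0)\qquad(\gamma\in\mathbb F_8^\times),$$ with these representatives $(X,Y,Z)$, and let $G\in\mathbb F_8^{6\times21}$ have rows the evaluations at these points of $$YZ^2,\quad ZX^2,\quad XY^2\ \text{(logical rows)},\qquad X,\quad Y,\quad Z\ \text{(stabilizer rows)}.$$ Then $G$ has full rank and satisfies $$\sum_i(g_{a,i})^4(g_{b,i})^2g_{c,i}=\begin{cases}1&1\le a=b=c\le3\\0&\text{otherwise}\end{cases}\qquad(1\le a,b,c\le6);$$ consequently applying the norm gate $N$ ($CCZ$ up to Paulis) to each of the 21 physical qudits acts on the code as the logical $N^{\otimes3}$; and the $Z$-distance of the code is $3$.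
   Context: An $\mathbb F_8$-qudit, with basis $|\gamma\rangle$, $\gamma\in\mathbb F_8$, is identified with three qubits via an $\mathbb F_2$-basis of $\mathbb F_8$. The norm gate is $N|\gamma\rangle=(-1)^{\gamma^7}|\gamma\rangle$ ($\gamma^7\in\{0,1\}$); up to global phase it equals $X^{\otimes3}\,CCZ\,X^{\otimes3}$. A full-rank matrix $G\in\mathbb F_8^{m\times n}$ with rows $\mathbf g_1,\dots,\mathbf g_m$ and $k$ logical rows defines a CSS code on $n$ qudits: the first $k$ rows are $X$-logical operators, the remaining rows generate the $X$-stabilizer space $\mathcal G_0$; logical basis states are $|\overline u\rangle\propto\sum_{\mathbf g\in\mathcal G_0}|\sum_{a\le k}u_a\mathbf g_a+\mathbf g\rangle$. ''Acts as the logical $N^{\otimes k}$'' means $N^{\otimes n}|\overline u\rangle=(-1)^{\sum_{a\le k}u_a^7}|\overline u\rangle$ for all $u\in\mathbb F_8^k$. The $Z$-distance is the minimum Hamming weight over $\mathbb F_8$ of a vector orthogonal (for $\sum x_iy_i$) to all stabilizer rows but not to at least one logical row. *)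

(* Defs.v *)
From HB Require Import structures.
From mathcomp Require Import all_boot all_order all_algebra all_field.

Set Implicit Arguments.
Unset Strict Implicit.
Unset Printing Implicit Defensive.

Import Order.TTheory GRing.Theory Num.Theory.
Local Open Scope ring_scope.

(** The complex numbers are an arbitrary [C : numClosedFieldType] (instances:
    [R[i]] over a real closed field [R], and [algC]).  A pure state of a system
    with computational basis [S] is its amplitude function [S -> C]; an operator
    is its matrix [U : S -> S -> C], with [U y x] = <y|U|x>.  A register of [n]
    systems with basis [S] has basis ['rV[S]_n]. *)

Section Operators.

Variables (C : numClosedFieldType) (S : finType).
Implicit Types U V : S -> S -> C.

Definition ket (x : S) : S -> C := fun y => (y == x)%:R.

Definition apply_op U (psi : S -> C) : S -> C :=
  fun y => \sum_x U y x * psi x.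

Definition comp_op U V : S -> S -> C :=
  fun y x => \sum_z U y z * V z x.

Definition tensor_power n U : 'rV[S]_n -> 'rV[S]_n -> C :=
  fun y x => \prod_(i < n) U (y 0 i) (x 0 i).

Definition eq_up_to_phase U V : Prop :=
  exists w : C, `|w| = 1 /\ forall y x, U y x = w * V y x.

End Operators.

Section Gates.

Variables (C : numClosedFieldType) (F : finFieldType).

(** (-1)^t, for [t] in the prime subfield {0, 1} of a field [F] of
    characteristic 2; it is only used for such [t]. *)
Definition sign_of (t : F) : C := (-1) ^+ (t == 1).

Definition norm_gate : F -> F -> C :=
  fun y x => if y == x then sign_of (x ^+ 7) else 0.

Definition pauliX : bool -> bool -> C := fun y x => (y == ~~ x)%:R.

Definition CCZ : 'rV[bool]_3 -> 'rV[bool]_3 -> C :=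
  fun y x => if y == x then (-1) ^+ [forall i, x 0 i] else 0.

Definition F2_combination (e : 'I_3 -> F) (x : 'rV[bool]_3) : F :=
  \sum_i e i *+ x 0 i.

(** For [F] of characteristic 2, [e] is a basis of [F] over its prime field
    {0, 1}: each element is a unique combination of the [e i]. *)
Definition F2_basis (e : 'I_3 -> F) : Prop := bijective (F2_combination e).

End Gates.

(** CSS codes: the first [k] rows of [G : 'M[F]_(k + r, n)] are the logical
    rows, the last [r] rows the stabilizer rows. *)
Section CSSCode.

Variables (F : finFieldType) (k r n : nat) (G : 'M[F]_(k + r, n)).

Definition logical_rows : 'M[F]_(k, n) := usubmx G.
Definition stabilizer_rows : 'M[F]_(r, n) := dsubmx G.

Definition stabilizer_space : {set 'rV[F]_n} :=
  [set g | (g <= stabilizer_rows)%MS].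

(** Normalized by |G_0|^(-1/2). *)
Definition logical_state (C : numClosedFieldType) (u : 'rV[F]_k) :
    'rV[F]_n -> C :=
  fun y => (sqrtC #|stabilizer_space|%:R)^-1 *
    \sum_(g in stabilizer_space)
      ket C (\sum_a u 0 a *: row a logical_rows + g) y.

Definition acts_as_logical_norm_gate (C : numClosedFieldType) : Prop :=
  forall u : 'rV[F]_k,
    apply_op (tensor_power (n := n) (norm_gate C (F := F))) (logical_state C u)
    =1 (fun y => sign_of C (\sum_a u 0 a ^+ 7) * logical_state C u y).

Definition dot (x y : 'rV[F]_n) : F := \sum_i x 0 i * y 0 i.

Definition hamming_weight (x : 'rV[F]_n) : nat := #|[set i | x 0 i != 0]|.

Definition nontrivial_Z (x : 'rV[F]_n) : Prop :=
  (forall s, dot x (row s stabilizer_rows) = 0) /\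
  (exists a, dot x (row a logical_rows) != 0).

Definition is_Z_distance (d : nat) : Prop :=
  (exists2 x, nontrivial_Z x & hamming_weight x = d) /\
  (forall x, nontrivial_Z x -> (d <= hamming_weight x)%N).

End CSSCode.

Section ProjectiveCode.

Variable F : finFieldType.

Definition coords (x y z : F) : 'rV[F]_3 := \row_i [:: x; y; z]`_i.

Definition points : {set 'rV[F]_3} :=
  [set coords 0 1 g | g : F & g != 0] :|:
  [set coords g 0 1 | g : F & g != 0] :|:
  [set coords 1 g 0 | g : F & g != 0].

Definition code_matrix (pt : 'I_21 -> 'rV[F]_3) : 'M[F]_(3 + 3, 21) :=
  \matrix_(a, i)
    let X := pt i 0 0 in let Y := pt i 0 1 in let Z := pt i 0 2 in
    [:: Y * Z ^+ 2; Z * X ^+ 2; X * Y ^+ 2; X; Y; Z]`_a.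

End ProjectiveCode.

(* Main.v *)
Require Import Defs.
From HB Require Import structures.
From mathcomp Require Import all_boot all_order all_algebra all_field.
From mathcomp Require Import ring.

Set Implicit Arguments.
Unset Strict Implicit.
Unset Printing Implicit Defensive.

Import Order.TTheory GRing.Theory Num.Theory.
Local Open Scope ring_scope.

(** Over F_8, the sum of g^k over nonzero g is 1 if 7 | k and 0 otherwise.
    Each of the three families of points lies on a coordinate line, so the sum of
    a monomial X^i Y^j Z^k over the 21 points can be read off the exponents.
    Both the trilinear identity and the full rank of the code matrix (a right
    inverse is given by evaluations of monomials) become finite checks on
    exponents.  The norm splits as y^7 = y^4 y^2 y, a product of Frobenius powers, so the
    trilinear identity computes sum_i y_i^7 for each codeword y.  The Z-distance
    is at least 3 because the columns of the stabilizer rows are distinct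
    projective points, and a collinear triple attains it. *)

(** * Diagonal gates and their conjugation by Pauli X *)

Section Gates.

Variable C : numClosedFieldType.

Lemma pauliX_tensor n (y x : 'rV[bool]_n) :
  tensor_power (@pauliX C) y x = (y == map_mx negb x)%:R.
Proof.
rewrite /tensor_power /pauliX; case: eqP => [->|ne].
  by rewrite big1 // => i _; rewrite mxE eqxx.
case: (pickP (fun i => y 0 i != ~~ x 0 i)) => [i ni|eq_yx].
  by rewrite (bigD1 i) //= (negbTE ni) mul0r.
case: ne; apply/rowP=> i; rewrite mxE.
by apply/eqP; have /negbFE := eq_yx i.
Qed.

Lemma map_negbK n : involutive (map_mx negb : 'rV[bool]_n -> 'rV[bool]_n).
Proof. by move=> x; apply/rowP=> i; rewrite !mxE negbK. Qed.

(** Conjugation by the involution that flips every bit keeps CCZ diagonal and moves its sign from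
    the all-ones state to the all-zeros state. *)
Lemma conj_CCZ (y x : 'rV[bool]_3) :
  comp_op (tensor_power (n := 3) (@pauliX C))
    (comp_op (@CCZ C) (tensor_power (n := 3) (@pauliX C))) y x
  = if y == x then (-1) ^+ [forall i, ~~ x 0 i] else 0.
Proof.
have inner z : comp_op (@CCZ C) (tensor_power (n := 3) (@pauliX C)) z x
    = CCZ C z (map_mx negb x).
  rewrite /comp_op (bigD1 (map_mx negb x)) //= big1 ?addr0.
    by rewrite pauliX_tensor eqxx mulr1.
  by move=> w /negbTE nw; rewrite pauliX_tensor nw mulr0.
rewrite {1}/comp_op (bigD1 (map_mx negb y)) //= big1 ?addr0; last first.
  move=> w nw; rewrite pauliX_tensor; case: eqP => [yw|]; last by rewrite mul0r.
  by rewrite yw map_negbK eqxx in nw.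
rewrite pauliX_tensor map_negbK eqxx mul1r inner /CCZ.
rewrite (inj_eq (inv_inj (@map_negbK _))).
by under eq_forallb => i do rewrite mxE.
Qed.

Lemma apply_norm_gates (F : finFieldType) n (psi : 'rV[F]_n -> C) y :
  apply_op (tensor_power (norm_gate C (F := F))) psi y
  = (\prod_i sign_of C (y 0 i ^+ 7)) * psi y.
Proof.
rewrite /apply_op (bigD1 y) //= big1 ?addr0.
  by congr (_ * _); apply: eq_bigr => i _; rewrite /norm_gate eqxx.
move=> x nxy; rewrite /tensor_power.
case: (pickP (fun i => y 0 i != x 0 i)) => [i ni|eq_yx].
  by rewrite (bigD1 i) //= /norm_gate (negbTE ni) !mul0r.
case/eqP: nxy; apply/rowP=> i.
by apply/esym/eqP; have /negbFE := eq_yx i.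
Qed.

End Gates.

(** * The 21 projective points and sums over them *)

Section ProjectivePoints.

Variable F : finFieldType.
Implicit Types (g x y z : F) (p : 'rV[F]_3).

Lemma coordsE x y z :
  (coords x y z 0 0 = x) * (coords x y z 0 1 = y) * (coords x y z 0 2 = z).
Proof. by rewrite !mxE. Qed.

Variant points_spec : 'rV[F]_3 -> Prop :=
  | PointsX g of g != 0 : points_spec (coords 0 1 g)
  | PointsY g of g != 0 : points_spec (coords g 0 1)
  | PointsZ g of g != 0 : points_spec (coords 1 g 0).

Lemma pointsP p : p \in points F -> points_spec p.
Proof. by rewrite !inE => /orP[/orP[]|] /imsetP[g]; rewrite inE => g0 ->; constructor. Qed.

Lemma coordsX_points g : g != 0 -> coords 0 1 g \in points F.
Proof. by move=> g0; rewrite !inE imset_f ?inE. Qed.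

Lemma big_disjointU (R : Type) (idx : R) (op : Monoid.com_law idx)
    (T : finType) (A B : {set T}) (f : T -> R) :
  [disjoint A & B] ->
  \big[op/idx]_(t in A :|: B) f t =
  op (\big[op/idx]_(t in A) f t) (\big[op/idx]_(t in B) f t).
Proof. by move=> dAB; rewrite -bigU //; apply: eq_bigl => t; rewrite !inE. Qed.

(** The families are disjoint: for any two of them, some coordinate is constantly 0 on one and
    constantly 1 on the other. *)
Lemma big_points (R : Type) (idx : R) (op : Monoid.com_law idx)
    (f : 'rV[F]_3 -> R) :
  \big[op/idx]_(p in points F) f p =
  op (op (\big[op/idx]_(g | g != 0) f (coords 0 1 g))
         (\big[op/idx]_(g | g != 0) f (coords g 0 1)))
     (\big[op/idx]_(g | g != 0) f (coords 1 g 0)).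
Proof.
have disj (A B : {set 'rV[F]_3}) :
    (forall p, p \in A -> p \in B -> False) -> [disjoint A & B].
  by move=> AB; apply/pred0P=> p /=; apply/negP=> /andP[/AB].
rewrite /points !big_disjointU.
- rewrite !big_imset.
  + by congr (op (op _ _) _); apply: eq_bigl => g; rewrite !inE.
  + by move=> g h _ _ /(congr1 (fun p => p 0 1)); rewrite !coordsE.
  + by move=> g h _ _ /(congr1 (fun p => p 0 0)); rewrite !coordsE.
  + by move=> g h _ _ /(congr1 (fun p => p 0 2)); rewrite !coordsE.
- apply: disj => p /imsetP[g g0 ->] /imsetP[h h0].
  move=> /(congr1 (fun p => p 0 1)) /eqP; rewrite !coordsE.
  by rewrite oner_eq0.
- apply: disj => p; rewrite inE.
  move=> /orP[] /imsetP[g g0 ->] /imsetP[h h0].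
    move=> /(congr1 (fun p => p 0 0)) /eqP; rewrite !coordsE.
    by rewrite eq_sym oner_eq0.
  move=> /(congr1 (fun p => p 0 2)) /eqP; rewrite !coordsE.
  by rewrite oner_eq0.
Qed.

(** Each representative has a coordinate normalized to 1. Within a family this forces the scalar
    between two proportional points to be 1; across families the coordinates give 1 = 0. *)
Lemma points_span_inj :
  {in points F &, injective (fun p => <<p>>%MS)}.
Proof.
move=> p q /pointsP pP /pointsP qP /genmxP/andP[/sub_rVP[a pq] _].
have eqc j : p 0 j = a * q 0 j by rewrite pq mxE.
move: (eqc 0) (eqc 1) (eqc 2) (oner_neq0 F).
case: pP qP {pq eqc} => g g0 [] h h0; rewrite !coordsE ?mulr0 ?mulr1.
- by move=> _ <- ->; rewrite mul1r.
- by move=> _ ->; rewrite eqxx.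
- by move=> <-; rewrite mul0r => ->; rewrite eqxx.
- by move=> _ <-; rewrite mul0r => ->; rewrite eqxx.
- by move=> -> _ <-; rewrite mul1r.
- by move=> _ _ ->; rewrite eqxx.
- by move=> ->; rewrite eqxx.
- by move=> -> _ <-; rewrite mul0r eqxx.
- by move=> <-; rewrite mul1r => ->.
Qed.

End ProjectivePoints.

(** * Power sums, the norm and signs over $\mathbb F_8$ *)

Section F8.

Variables (F : finFieldType) (C : numClosedFieldType).
Hypothesis cardF : #|F| = 8%N.

Lemma pchar2_F8 : 2%N \in [pchar F].
Proof. exact: (card_finPcharP (n := 3)). Qed.

Lemma natr_F8 n : n%:R = (odd n)%:R :> F.
Proof.
by rewrite -{1}(odd_double_half n) natrD -muln2 natrM (pcharf0 pchar2_F8) mulr0 addr0.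
Qed.

Lemma card_points : #|points F| = 21%N.
Proof.
rewrite -sum1_card big_points /= !sum_nat_const !muln1.
by rewrite (_ : #|_| = 7%N) // (cardC1 (0 : F)) cardF.
Qed.

Lemma expf7 (g : F) : g != 0 -> g ^+ 7 = 1.
Proof. by move=> g0; apply: (mulfI g0); rewrite -exprS -cardF expf_card mulr1. Qed.

Lemma exp7E (g : F) : g ^+ 7 = (g != 0)%:R.
Proof. by have [->|/expf7] := eqVneq g 0; rewrite ?expr0n. Qed.

(** As 7 is prime, such an element generates the multiplicative group. *)
Lemma ex_F8_gen : exists2 h : F, h != 0 & h != 1.
Proof.
have /set0Pn[h] : ~: [set 0; 1] != set0 :> {set F}.
  by rewrite -card_gt0 cardsCs setCK cardF cards2; case: (_ != _).
by rewrite !inE negb_or => /andP[h0 h1]; exists h.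
Qed.

(** If 7 divides k, there are seven terms 1, and 7 = 1 in characteristic 2. Otherwise the
    substitution of hg for g multiplies the sum by $h^k \ne 1$, so the sum is 0. *)
Lemma sum_expf k : \sum_(g : F | g != 0) g ^+ k = (7 %| k)%:R.
Proof.
have [/dvdnP[q ->]|n7k] := boolP (7 %| k)%N.
  under eq_bigr => g g0 do rewrite mulnC exprM expf7 // expr1n.
  by rewrite (sumr_const (predC1 (0 : F))) cardC1 cardF [LHS]natr_F8.
have [h h0 h1] := ex_F8_gen.
have hk : h ^+ k != 1.
  apply: contra h1 => /eqP hk1.
  have k0 : (0 < k)%N by case: k n7k {hk1}.
  have: coprime k 7 by rewrite coprime_sym prime_coprime.
  (* With uk = 7v + 1, the equation $h^k = 1$ would give h = 1. *)
  case: (egcdnP 7 k0) => u v eq_uv _ /eqP gk; rewrite gk in eq_uv.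
  have: h ^+ (u * k) = h ^+ (v * 7 + 1) by rewrite eq_uv.
  rewrite exprD expr1 mulnC exprM hk1 expr1n mulnC exprM expf7 // expr1n mul1r.
  by move=> <-.
have: (h ^+ k - 1) * \sum_(g : F | g != 0) g ^+ k = 0.
  rewrite mulrBl mul1r mulr_sumr [X in _ - X](reindex_onto ( *%R h) ( *%R h^-1)) /=.
    apply/eqP; rewrite subr_eq0; apply/eqP/eq_big => g.
      by rewrite mulKf // eqxx andbT mulf_eq0 negb_or h0.
    by rewrite exprMn.
  by move=> g _; rewrite mulVKf.
by move/eqP; rewrite mulf_eq0 subr_eq0 (negbTE hk) => /eqP ->.
Qed.

(** On each family one coordinate is 0, so the monomial survives only if the exponent of that
    coordinate is 0 (with $0^0 = 1$); what remains is a power sum in g. *)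
Lemma sum_points_monomial i j k :
  \sum_(p in points F) p 0 0 ^+ i * p 0 1 ^+ j * p 0 2 ^+ k
  = (((i == 0) && (7 %| k))%N + ((j == 0) && (7 %| i))%N
     + ((k == 0) && (7 %| j))%N)%:R.
Proof.
rewrite big_points /= !natrD -!mulnb !natrM -!sum_expf !mulr_sumr.
congr (_ + _ + _); apply: eq_bigr => g _; rewrite !coordsE !expr0n !expr1n.
- by rewrite mulr1.
- by rewrite mulr1 mulrC.
- by rewrite mul1r mulrC.
Qed.

(** [sign_of] turns sums into products on the prime subfield, where all seventh powers lie by
    [exp7E]. *)
Lemma sign_sum (I : finType) (f : I -> F) :
  \prod_i sign_of C (f i ^+ 7) = sign_of C (\sum_i f i ^+ 7).
Proof.
have signE (n : nat) : sign_of C (n%:R : F) = (-1) ^+ n.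
  rewrite natr_F8 /sign_of -[RHS]signr_odd.
  by case: (odd n); rewrite ?eqxx // eq_sym oner_eq0.
under eq_bigr do rewrite exp7E signE.
under [in RHS]eq_bigr do rewrite exp7E.
by rewrite -natr_sum signE prodrXr.
Qed.

(** N gives sign 1 at 0 and -1 elsewhere, and the conjugated CCZ the opposite signs; hence the phase
    -1. Any basis will do, since the zero bit vector always encodes 0. *)
Lemma norm_gate_CCZ (e : 'I_3 -> F) :
  F2_basis e ->
  eq_up_to_phase
    (fun y x => norm_gate C (F2_combination e y) (F2_combination e x))
    (comp_op (tensor_power (n := 3) (@pauliX C))
      (comp_op (@CCZ C) (tensor_power (n := 3) (@pauliX C)))).
Proof.
move=> /bij_inj e_inj; exists (-1); split=> [|y x]; first by rewrite normrN1.
rewrite conj_CCZ /norm_gate (inj_eq e_inj).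
case: ifP => _; last by rewrite mulr0.
have e0 : F2_combination e 0 = 0.
  by rewrite /F2_combination big1 // => i _; rewrite mxE.
have -> : [forall i, ~~ x 0 i] = (x == 0).
  apply/forallP/eqP=> [x0|-> i]; last by rewrite mxE.
  by apply/rowP=> i; rewrite mxE; apply/negbTE.
rewrite exp7E -(inj_eq e_inj) e0 /sign_of.
case: (F2_combination e x == 0); last by rewrite eqxx mulr1.
by rewrite eq_sym oner_eq0 mulrNN mulr1.
Qed.

(** * Trilinear identity and rank of the code matrix *)

Section Code.

Variable pt : 'I_21 -> 'rV[F]_3.
Hypothesis pt_inj : injective pt.
Hypothesis pt_im : [set pt i | i : 'I_21] = points F.
Let G : 'M[F]_(3 + 3, 21) := code_matrix pt.

Lemma pt_points i : pt i \in points F.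
Proof. by rewrite -pt_im imset_f. Qed.

Lemma pt_surj p : p \in points F -> exists i, pt i = p.
Proof. by rewrite -pt_im => /imsetP[i _ ->]; exists i. Qed.

Definition exponents (a : nat) : nat * nat * nat :=
  nth (0, 0, 0) [:: (0, 1, 2); (2, 0, 1); (1, 2, 0);
                    (1, 0, 0); (0, 1, 0); (0, 0, 1)]%N a.

(* Monomials dual to the rows for the pairing [sum_i f(pt i) g(pt i)]. *)
Definition dual_exponents (a : nat) : nat * nat * nat :=
  nth (0, 0, 0) [:: (0, 1, 5); (5, 0, 1); (1, 5, 0);
                    (7, 7, 0); (0, 7, 7); (7, 0, 7)]%N a.

Definition monomial (m : nat * nat * nat) (p : 'rV[F]_3) : F :=
  p 0 0 ^+ m.1.1 * p 0 1 ^+ m.1.2 * p 0 2 ^+ m.2.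

(** The count in [sum_points_monomial] modulo 2, as a boolean so that [vm_compute] can decide
    statements about exponents. *)
Definition support_parity (m : nat * nat * nat) : bool :=
  odd (((m.1.1 == 0) && (7 %| m.2)) + ((m.1.2 == 0) && (7 %| m.1.1))
       + ((m.2 == 0) && (7 %| m.1.2)))%N.

Lemma code_matrixE a i : G a i = monomial (exponents a) (pt i).
Proof.
rewrite mxE /monomial.
by case: a => [] [|[|[|[|[|[|//]]]]]] a6 /=; rewrite ?expr0 ?expr1; ring.
Qed.

Lemma sum_monomial m : \sum_i monomial m (pt i) = (support_parity m)%:R.
Proof.
rewrite -natr_F8 -sum_points_monomial -pt_im big_imset //=.
by move=> i j _ _; apply: pt_inj.
Qed.

Lemma all_rows (P : nat -> bool) : all P (iota 0 6) -> forall a : 'I_6, P a.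
Proof. by move=> /allP aP a; apply: aP; rewrite mem_iota ltn_ord. Qed.

Lemma code_trilinear (a b c : 'I_6) :
  \sum_i G a i ^+ 4 * G b i ^+ 2 * G c i
    = [&& a == b, b == c & (a < 3)%N]%:R.
Proof.
(* The summand is again a monomial, with exponents 4, 2 and 1 times those of the three rows; this
   leaves 216 parity checks. *)
pose e (a b c : nat) (f : nat * nat * nat -> nat) :=
  (f (exponents a) * 4 + f (exponents b) * 2 + f (exponents c))%N.
pose m a b c := (e a b c (fun m => m.1.1), e a b c (fun m => m.1.2), e a b c snd).
rewrite (eq_bigr (fun i => monomial (m a b c) (pt i))) => [|i _].
  rewrite sum_monomial -!val_eqE.
  have /all_rows/(_ a)/all_rows/(_ b)/all_rows/(_ c)/eqP -> // :
    all (fun a => all (fun b => all (fun c =>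
      support_parity (m a b c) == [&& a == b, b == c & a < 3]%N)
    (iota 0 6)) (iota 0 6)) (iota 0 6) by vm_compute.
rewrite !code_matrixE /monomial /m /e /= !exprD !exprM; ring.
Qed.

Lemma code_row_free : row_free G.
Proof.
(* Seventh powers are indicators of nonzero coordinates: $X^7Y^7$ selects the family $(1:\gamma:0)$,
   on which X is constantly 1 while Y and Z sum to 0. *)
apply/row_freeP; exists (\matrix_(i, b) monomial (dual_exponents b) (pt i)).
apply/matrixP=> a b; rewrite !mxE.
pose e (f : nat * nat * nat -> nat) (a b : nat) :=
  (f (exponents a) + f (dual_exponents b))%N.
pose m a b := (e (fun m => m.1.1) a b, e (fun m => m.1.2) a b, e snd a b).
rewrite (eq_bigr (fun i => monomial (m a b) (pt i))) => [|i _].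
  rewrite sum_monomial -val_eqE.
  have /all_rows/(_ a)/all_rows/(_ b)/eqP -> // :
    all (fun a => all (fun b => support_parity (m a b) == (a == b))
      (iota 0 6)) (iota 0 6) by vm_compute.
rewrite code_matrixE mxE /monomial /m /e /= !exprD; ring.
Qed.

(** * Logical action of the norm gates *)

Lemma sum_exp7_codeword (w : 'I_6 -> F) :
  \sum_i (\sum_a w a * G a i) ^+ 7 = \sum_(a < 6 | (a < 3)%N) w a ^+ 7.
Proof.
have frob k (f : 'I_6 -> F) : (\sum_a f a) ^+ (2 ^ k) = \sum_a f a ^+ (2 ^ k).
  elim: k => [|k IH]; first by [].
  rewrite expnSr exprM IH -(pFrobenius_autE pchar2_F8) rmorph_sum.
  by apply: eq_bigr => a _ /=; rewrite pFrobenius_autE exprM.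
transitivity (\sum_a \sum_b \sum_c w a ^+ 4 * w b ^+ 2 * w c *
    \sum_i G a i ^+ 4 * G b i ^+ 2 * G c i).
  under [RHS]eq_bigr => a _ do under eq_bigr => b _ do
    (under eq_bigr => c _ do rewrite mulr_sumr; rewrite exchange_big /=).
  under [RHS]eq_bigr => a _ do rewrite exchange_big /=.
  rewrite [RHS]exchange_big /=; apply: eq_bigr => i _.
  rewrite -[7%N]/(2 ^ 2 + 2 ^ 1 + 1)%N !exprD !frob expr1 -mulrA mulr_suml.
  apply: eq_bigr => a _; rewrite mulr_suml mulr_sumr.
  apply: eq_bigr => b _; rewrite !mulr_sumr.
  by apply: eq_bigr => c _; rewrite !exprMn; ring.
(* The trilinear identity kills every term off the diagonal a = b = c, and the diagonal terms of the
   stabilizer rows. *)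
rewrite [RHS]big_mkcond; apply: eq_bigr => a _.
rewrite (bigD1 a) //= [X in _ + X]big1 ?addr0 => [|b nb]; last first.
  rewrite big1 // => c _.
  by rewrite code_trilinear eq_sym (negbTE nb) mulr0.
rewrite (bigD1 a) //= [X in _ + X]big1 ?addr0 => [|c nc]; last first.
  by rewrite code_trilinear eqxx eq_sym (negbTE nc) mulr0.
rewrite code_trilinear !eqxx /=; case: ifP => _; last by rewrite mulr0.
by rewrite mulr1 -!exprD -exprSr.
Qed.

(** The physical gate is diagonal, so it suffices to compare signs at each y in the support of the
    logical state. There y is a codeword, and its sign depends on u alone, not on the stabilizer
    component. *)
Lemma code_logical_norm_gate : acts_as_logical_norm_gate G C.
Proof.
move=> u y; rewrite apply_norm_gates.
have [/existsP[g /andP[Gg /eqP yg]]|/existsPn noy] := boolP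
  [exists g in stabilizer_space G, y == \sum_a u 0 a *: row a (logical_rows G) + g].
  congr (_ * _).
  move: Gg; rewrite inE => /submxP[v gv].
  have yE i : y 0 i = \sum_(a < 3 + 3) row_mx u v 0 a * G a i.
    have mulG : row_mx u v *m G = u *m usubmx G + v *m dsubmx G.
      by rewrite -{1}[G]vsubmxK mul_row_col.
    transitivity ((row_mx u v *m G) 0 i); last by rewrite mxE.
    rewrite mulG yg gv !mxE summxE; congr (_ + _).
    by apply: eq_bigr => a _; rewrite !mxE.
  rewrite sign_sum; congr sign_of.
  under eq_bigr do rewrite yE.
  rewrite sum_exp7_codeword big_mkcond (@big_split_ord _ _ _ 3 3) /= [X in _ + X]big1 //.
  by rewrite addr0; apply: eq_bigr => a _; rewrite ltn_ord row_mxEl.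
have -> : logical_state G C u y = 0; last by rewrite !mulr0.
rewrite /logical_state big1 ?mulr0 // => g Gg.
by have := noy g; rewrite Gg /ket /= => /negbTE ->.
Qed.

(** * The Z-distance *)

Lemma dot_stabilizer_row x s :
  dot x (row s (stabilizer_rows G)) = (\sum_i x 0 i *: pt i) 0 s.
Proof.
rewrite summxE; apply: eq_bigr => i _; rewrite !mxE; congr (_ * _).
by case: s => [] [|[|[|//]]] s3 /=; congr (pt i 0 _); apply: val_inj.
Qed.

(** Orthogonality to the stabilizer rows is a linear dependence among the columns [pt i] with
    coefficients x. Weight 0 contradicts nontriviality, weight 1 would make a point zero, and weight
    2 would make two distinct points proportional. *)
Lemma code_Z_distance_ge x : nontrivial_Z G x -> (3 <= hamming_weight x)%N.
Proof.
case=> stab [a log_a]; rewrite ltnNge; apply/negP=> wt2.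
have rel : \sum_i x 0 i *: pt i = 0.
  by apply/rowP=> s; rewrite -dot_stabilizer_row stab mxE.
have [i xi] : exists i, x 0 i != 0.
  apply/existsP; apply: contraNT log_a => /existsPn x0.
  by rewrite /dot big1 // => i _; have /negbNE/eqP -> := x0 i; rewrite mul0r.
have : (#|[set j | x 0%R j != 0%R] :\ i| <= 1)%N.
  by move: wt2; rewrite /hamming_weight (cardsD1 i) inE xi.
rewrite leq_eqVlt ltnS leqn0 cards_eq0.
have pt_neq0 j : pt j != 0.
  have := pt_points j; case/pointsP => g g0; apply/eqP.
  - by move=> /(congr1 (fun p : 'rV[F]_3 => p 0 1)) /eqP; rewrite coordsE mxE oner_eq0.
  - by move=> /(congr1 (fun p : 'rV[F]_3 => p 0 2)) /eqP; rewrite coordsE mxE oner_eq0.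
  - by move=> /(congr1 (fun p : 'rV[F]_3 => p 0 0)) /eqP; rewrite coordsE mxE oner_eq0.
case/orP=> [/cards1P[j Sj]|/eqP S0]; last first.
  move/eqP: rel; rewrite (bigD1 i) //= big1 => [|k ki].
    by rewrite addr0 scaler_eq0 (negbTE xi) (negbTE (pt_neq0 i)).
  have := in_set0 k; rewrite -S0 !inE ki /= => /negbFE /eqP ->.
  by rewrite scale0r.
have : j \in [set j] by rewrite inE.
rewrite -Sj !inE => /andP[ji xj].
move: rel; rewrite (bigD1 i) //= (bigD1 j) //= big1 ?addr0.
  move/eqP; rewrite addr_eq0 -scaleNr => /eqP xij.
  case/eqP: ji; apply/pt_inj/points_span_inj; try exact: pt_points.
  have nxj : - x 0 j != 0 by rewrite oppr_eq0.
  rewrite -(eq_genmx (eqmx_scale (pt i) xi)) xij.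
  by rewrite (eq_genmx (eqmx_scale _ nxj)).
move=> k /andP[ki kj]; have := in_set1 k j.
by rewrite -Sj !inE ki (negbTE kj) /= => /negbFE /eqP ->; rewrite scale0r.
Qed.

(* The points [(0 : 1 : g)] for [g = 1, h, 1 + h] are collinear; in
   characteristic 2 their linear dependence has coefficients [g]. *)
Lemma code_Z_distance_witness :
  exists2 x, nontrivial_Z G x & hamming_weight x = 3%N.
Proof.
have [h h0 h1] := ex_F8_gen.
have h10 : 1 + h != 0.
  by rewrite addrC -(GRing.subr_pchar2 pchar2_F8) subr_eq0.
have [i1 pt1] := pt_surj (coordsX_points (oner_neq0 F)).
have [i2 pt2] := pt_surj (coordsX_points h0).
have [i3 pt3] := pt_surj (coordsX_points h10).
have gE i g : pt i = coords 0 1 g -> pt i 0 2 = g by move=> ->; rewrite coordsE.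
have i12 : i1 != i2.
  by apply: contra h1 => /eqP i12; rewrite -(gE _ _ pt1) -(gE _ _ pt2) i12.
have i13 : i1 != i3.
  apply: contra h0 => /eqP i13; rewrite -(addr0 h) -(subrr (1 : F)) addrCA addrA.
  by rewrite -{1}(gE _ _ pt3) -i13 (gE _ _ pt1) subrr.
have i23 : i2 != i3.
  apply/eqP=> i23; have := gE _ _ pt2; rewrite i23 (gE _ _ pt3) => /eqP.
  by rewrite -subr_eq0 addrK oner_eq0.
pose x : 'rV[F]_21 :=
  delta_mx 0 i1 + h *: delta_mx 0 i2 + (1 + h) *: delta_mx 0 i3.
have xE i : x 0 i = (i == i1)%:R + h * (i == i2)%:R + (1 + h) * (i == i3)%:R.
  by rewrite !mxE.
have dot_x v : dot x v = v 0 i1 + h * v 0 i2 + (1 + h) * v 0 i3.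
  have sumE k c : \sum_i c * (i == k)%:R * v 0 i = c * v 0 k.
    rewrite (bigD1 k) //= eqxx mulr1 big1 ?addr0 // => i /negbTE ->.
    by rewrite mulr0 mul0r.
  rewrite -[v 0 i1]mul1r -!sumE -!big_split; apply: eq_bigr => i _.
  by rewrite xE mul1r /=; ring.
have char2 (t : F) : t + t = 0 by exact: addrr_pchar2 pchar2_F8 t.
exists x; last first.
  rewrite /hamming_weight (_ : [set i | _] = i1 |: (i2 |: [set i3])).
    by rewrite !cardsU1 cards1 !inE negb_or i12 i13 i23.
  apply/setP=> i; rewrite !inE xE.
  have [->|n1] := eqVneq i i1.
    by rewrite (negbTE i12) (negbTE i13) !mulr0 !addr0 oner_neq0.
  have [->|n2] := eqVneq i i2.
    by rewrite (negbTE i23) mulr0 addr0 add0r mulr1 h0.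
  have [_|_] := eqVneq i i3; first by rewrite mulr0 !add0r mulr1 h10.
  by rewrite !mulr0 !addr0 eqxx.
split=> [s|].
  rewrite dot_x !mxE pt1 pt2 pt3 !coordsE.
  case: s => [] [|[|[|//]]] s3 /=.
  - by rewrite !mulr0 !addr0.
  - by rewrite !mulr1 char2.
  - transitivity ((1 + 1) + (h + h) + (h * h + h * h)); first by ring.
    by rewrite !char2.
(* The logical row $YZ^2$ takes the value $g^2$ at (0 : 1 : g), so the pairing is $1 + h^3 + (1+h)^3
   = h(1+h)$ in characteristic 2, which is nonzero. *)
exists 0; rewrite dot_x !mxE pt1 pt2 pt3 !coordsE /=.
have -> : 1 * 1 ^+ 2 + h * (1 * h ^+ 2) + (1 + h) * (1 * (1 + h) ^+ 2)
    = h * (1 + h) + (1 + 1) * (1 + h + h ^+ 2 + h ^+ 3) by ring.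
by rewrite char2 mul0r addr0 mulf_neq0.
Qed.

End Code.

End F8.

Theorem mainTheorem9 (F : finFieldType) (C : numClosedFieldType)
    (cardF : #|F| = 8%N) :
  [/\ (* the 21 representatives give 21 distinct points of the plane *)
      #|points F| = 21%N,
      {in points F &, injective (fun p : 'rV[F]_3 => <<p>>%MS)},
      (* on three qubits, N is CCZ up to Paulis and a global phase *)
      forall e : 'I_3 -> F, F2_basis e ->
        eq_up_to_phase
          (fun y x => norm_gate C (F2_combination e y) (F2_combination e x))
          (comp_op (tensor_power (n := 3) (@pauliX C))
            (comp_op (@CCZ C) (tensor_power (n := 3) (@pauliX C)))) &
      (* the columns are indexed by the points, in any order *)
      forall pt : 'I_21 -> 'rV[F]_3,
        injective pt -> [set pt i | i : 'I_21] = points F ->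
        let G := code_matrix pt in
        [/\ row_free G,
            forall a b c : 'I_6,
              \sum_i G a i ^+ 4 * G b i ^+ 2 * G c i
                = (if [&& a == b, b == c & (a < 3)%N] then 1 else 0),
            acts_as_logical_norm_gate G C &
            is_Z_distance G 3]].
Proof.
split; [exact: card_points | exact: points_span_inj | exact: norm_gate_CCZ |].
move=> pt pt_inj pt_im G; split.
- exact: code_row_free.
- by move=> a b c; rewrite code_trilinear //; case: ifP.
- exact: code_logical_norm_gate.
split; first exact: code_Z_distance_witness.
by move=> x; apply: code_Z_distance_ge.
Qed.
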